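(* Let $A_1,\dots,A_m\in\mathbb{S}^n$ and $b\in\mathbb{R}^m$, $b\ne0$, and let $$\mathbf{P}=\{X\in\mathbb{S}^n: A_i\bullet X=b_i,\ i=1,\dots,m,\ X\succeq0\}.$$ Suppose $\mathbf{P}$ has no recession direction, i.e. $$\{D\in\mathbb{S}^n: A_i\bullet D=0,\ i=1,\dots,m,\ D\succeq0,\ D\ne0\}=\emptyset.$$ Let $\mathbf{S}'=\{A_1',\dots,A_m'\}\subset\mathbb{S}^{n+1}$, where $$A_i'=\mathrm{diag}(A_i,-b_i)=\begin{pmatrix}A_i&0\\0&-b_i\end{pmatrix}.$$ Then $\mathbf{P}$ is feasible (nonempty) if and only if $$0\in SH(\mathbf{S}')=\left\{(A_1'\bullet X',\dots,A_m'\bullet X')^T: X'\in\mathbf{\Delta}_{n+1}\right\}.$$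
   Context: $\mathbb{S}^n$ is the space of real symmetric $n\times n$ matrices with inner product $X\bullet Y=\mathrm{Tr}(XY)$; $X\succeq0$ means positive semidefinite. The spectraplex is $\mathbf{\Delta}_k=\{X\in\mathbb{S}^k:\mathrm{Tr}(X)=1,\ X\succeq0\}$. *)

(* Defs.v *)
From mathcomp Require Import all_boot all_order all_algebra.
From mathcomp Require Import all_classical all_reals.

Set Implicit Arguments.
Unset Strict Implicit.
Unset Printing Implicit Defensive.

Import Order.TTheory GRing.Theory Num.Theory.

Local Open Scope classical_set_scope.
Local Open Scope ring_scope.

Definition frob (R : realType) (n : nat) (X Y : 'M[R]_n) : R := \tr (X *m Y).

(* The quadratic-form half of X >= 0; symmetry is imposed separately. *)
Definition psdmx (R : realType) (n : nat) (X : 'M[R]_n) : Prop :=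
  forall v : 'cV[R]_n, 0 <= (v^T *m X *m v) 0 0.

Definition spectraplex (R : realType) (k : nat) : set 'M[R]_k :=
  [set X | [/\ X \is symmetricmx, \tr X = 1 & psdmx X]].

Definition spectrahedron (R : realType) (m n : nat)
    (A : 'I_m -> 'M[R]_n) (b : 'cV[R]_m) : set 'M[R]_n :=
  [set X | [/\ X \is symmetricmx, forall i, frob (A i) X = b i 0 & psdmx X]].

Definition recession_directions (R : realType) (m n : nat)
    (A : 'I_m -> 'M[R]_n) : set 'M[R]_n :=
  [set D | [/\ D \is symmetricmx, forall i, frob (A i) D = 0, psdmx D
             & D != 0]].

(* SH(S); S is an indexed family, as the index orders the coordinates. *)
Definition spectrahull (R : realType) (m k : nat)
    (S : 'I_m -> 'M[R]_k) : set 'cV[R]_m :=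
  [set \col_i frob (S i) X | X in @spectraplex R k].

Definition homogenized (R : realType) (m n : nat)
    (A : 'I_m -> 'M[R]_n) (b : 'cV[R]_m) (i : 'I_m) : 'M[R]_(n + 1) :=
  block_mx (A i) 0 0 (- b i 0)%:M.

(* Main.v *)
(* P is the slice at height 1 of the cone {(X, t) : A_i . X = t b_i}.  A point
   of the spectraplex annihilated by every A_i' has a corner entry t >= 0; if
   t > 0, rescaling its upper-left block by 1/t lands in P, and if t = 0, that
   block has trace 1 and is a recession direction. *)

Require Import Defs.
From mathcomp Require Import all_boot all_order all_algebra.
From mathcomp Require Import all_classical all_reals.

Set Implicit Arguments.
Unset Strict Implicit.
Unset Printing Implicit Defensive.

Import Order.TTheory GRing.Theory Num.Theory.

Local Open Scope classical_set_scope.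
Local Open Scope ring_scope.

(** [symmetricmx] is the hermitian predicate with sign exponent 0 and the identity as conjugation;
    both decorations simplify away. *)
Lemma symmetricmxP (R : realType) (n : nat) (X : 'M[R]_n) :
  reflect (X^T = X) (X \is symmetricmx).
Proof.
rewrite qualifE /= expr0 scale1r map_mx_id // eq_sym.
exact: eqP.
Qed.

Lemma psdmx_diag_ge0 (R : realType) (n : nat) (X : 'M[R]_n) (i : 'I_n) :
  psdmx X -> 0 <= X i i.
Proof.
by move=> /(_ (delta_mx i 0)); rewrite trmx_delta -rowE -colE !mxE.
Qed.

Lemma psdmx_trace_ge0 (R : realType) (n : nat) (X : 'M[R]_n) :
  psdmx X -> 0 <= \tr X.
Proof. by move=> hX; apply: sumr_ge0 => i _; exact: psdmx_diag_ge0. Qed.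

Lemma psdmxZ (R : realType) (n : nat) (c : R) (X : 'M[R]_n) :
  0 <= c -> psdmx X -> psdmx (c *: X).
Proof.
by move=> c0 hX v; rewrite -scalemxAr -scalemxAl mxE mulr_ge0.
Qed.

(** Test vectors padded with zeros see only the upper-left block. *)
Lemma psdmx_ulsubmx (R : realType) (n p : nat) (X : 'M[R]_(n + p)) :
  psdmx X -> psdmx (ulsubmx X).
Proof.
move=> hX v; have := hX (col_mx v 0).
rewrite -{1}[X]submxK tr_col_mx mul_row_block mul_row_col.
by rewrite trmx0 !mul0mx mulmx0 !addr0.
Qed.

(** Without off-diagonal blocks there are no cross terms, so the quadratic form is a sum over the
    two halves of [v]. *)
Lemma psdmx_block_diag (R : realType) (n p : nat)
    (X : 'M[R]_n) (Y : 'M[R]_p) :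
  psdmx X -> psdmx Y -> psdmx (block_mx X 0 0 Y).
Proof.
move=> hX hY v; rewrite -[v]vsubmxK tr_col_mx mul_row_block mul_row_col.
by rewrite !mulmx0 addr0 add0r mxE addr_ge0.
Qed.

Lemma frobZr (R : realType) (n : nat) (c : R) (A X : 'M[R]_n) :
  frob A (c *: X) = c * frob A X.
Proof. by rewrite /frob -scalemxAr mxtraceZ. Qed.

(** [u] and [w] are arbitrary because a spectraplex point need not be block diagonal; in the trace
    they meet only zero blocks. *)
Lemma frob_homogenized (R : realType) (m n : nat)
    (A : 'I_m -> 'M[R]_n) (b : 'cV[R]_m) (i : 'I_m)
    (X : 'M[R]_n) (u : 'M[R]_(n, 1)) (w : 'M[R]_(1, n)) (Y : 'M[R]_1) :
  frob (homogenized A b i) (block_mx X u w Y) = frob (A i) X - b i 0 * Y 0 0.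
Proof.
rewrite /frob /homogenized mulmx_block mxtrace_block !mul0mx addr0 add0r.
by rewrite mul_scalar_mx mxtraceZ trace_mx11 mulNr.
Qed.

Theorem proposition2 (R : realType) (m n : nat)
    (A : 'I_m -> 'M[R]_n) (b : 'cV[R]_m)
    (hA : forall i, A i \is symmetricmx)
    (hb : b != 0)
    (hrec : recession_directions A = set0) :
  spectrahedron A b !=set0 <-> spectrahull (homogenized A b) 0.
Proof.
split=> [[X [symX eqX psdX]] | [X [symX trX psdX] eqX]].
- have d0 : 0 < \tr X + 1 by rewrite ltr_wpDl ?psdmx_trace_ge0.
  (* Lift [X] to height 1, then divide by the trace of the lift; the homogeneous equations survive
     the scaling. *)
  exists ((\tr X + 1)^-1 *: block_mx X 0 0 1%:M); [split|].
  + apply/symmetricmxP; rewrite linearZ /= tr_block_mx !trmx0 tr_scalar_mx.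
    by rewrite (symmetricmxP _ symX).
  + by rewrite mxtraceZ mxtrace_block mxtrace1 mulVf ?gt_eqF.
  + apply: psdmxZ; first by rewrite invr_ge0 ltW.
    apply: psdmx_block_diag => // v.
    (* On the corner block the form is [v^T *m v], a sum of squares. *)
    by rewrite mulmx1 mxE sumr_ge0 // => j _; rewrite mxE -expr2 sqr_ge0.
  + apply/colP => i; rewrite !mxE frobZr frob_homogenized eqX mxE.
    by rewrite mulr1 subrr mulr0.
- set Y := ulsubmx X; set t := drsubmx X 0 0.
  have eqY i : frob (A i) Y = b i 0 * t.
    move/colP: eqX => /(_ i); rewrite !mxE -{1}[X]submxK frob_homogenized.
    by move/eqP; rewrite subr_eq0 => /eqP.
  have symY : Y^T = Y.
    by rewrite /Y trmx_ulsub (symmetricmxP _ symX).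
  have psdY : psdmx Y by exact: psdmx_ulsubmx.
  have t0 : 0 <= t by rewrite /t !mxE psdmx_diag_ge0.
  have trY : \tr Y + t = 1.
    by rewrite -trX -[in RHS](submxK X) mxtrace_block trace_mx11.
  have [t_eq0 | t_neq0] := eqVneq t 0.
    suff : recession_directions A Y by rewrite hrec.
    split=> //; first by apply/symmetricmxP.
    + by move=> i; rewrite eqY t_eq0 mulr0.
    (* With [t] zero, a zero [Y] would turn [trY] into 0 = 1. *)
    + apply/eqP => Y0; move: trY.
      by rewrite Y0 t_eq0 mxtrace0 addr0 => /esym/eqP; rewrite oner_eq0.
  (* Invertibility of [t] restores the right-hand sides [b i 0]; its sign [t0] keeps the rescaled
     block positive semidefinite. *)
  exists (t^-1 *: Y); split.
  + by apply/symmetricmxP; rewrite linearZ /= symY.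
  + by move=> i; rewrite frobZr eqY mulrCA mulVf ?mulr1.
  + by apply: psdmxZ; rewrite ?invr_ge0.
Qed.
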